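(* In the real (resp. complex) projective 3-space, let $f,f_{12},f_{13},f_{23}$ be four points in general position and let $f_1,f_2,f_3$ be three lines. Assume that the three tiles with vertices labeled in cyclic order by $$(f,f_1,f_{12},f_2),\quad (f,f_1,f_{13},f_3),\quad (f,f_2,f_{23},f_3)$$ are coherent, and that the seven inputs $f,f_i,f_{ij}$ are generic subject to the conditions that the four points $f,f_{12},f_{13},f_{23}$ are in general position and that these three tiles are coherent. (In particular, the three lines $f_1,f_2,f_3$ lie in one plane $h$.) Then there exists a unique line $f_{123}$ such that the three tiles $$(f_1,f_{12},f_{123},f_{13}),\quad (f_2,f_{12},f_{123},f_{23}),\quad (f_3,f_{13},f_{123},f_{23})$$ are coherent. Specifically, $f_{123}=h\cap(f_{12}f_{13}f_{23})$, which is the Desargues line for the perspective triangles with vertices $f_{12},f_{13},f_{23}$ and with sides $f_1,f_2,f_3$.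
   Context: $(XY)$ and $(XYZ)$ denote the line, resp. plane, spanned by the given points. Coherence of a tile in 3-space labeled by points and lines: for distinct points $A,B$ and distinct lines $\ell,m$ in projective 3-space, the tile with vertices labeled cyclically $A,\ell,B,m$ is coherent if neither $A$ nor $B$ is incident to either $\ell$ or $m$, the lines $\ell$ and $m$ intersect at some point $P$, and the line $(AB)$ passes through $P$. The notion does not depend on which of the four vertices is listed first or on the direction of listing. The Desargues line of two perspective triangles is the line containing the three intersection points of corresponding sides; here the side $f_i$ corresponds to the side $(f_{ij}f_{ik})$, where $\{i,j,k\}=\{1,2,3\}$. ''Generic'' means belonging to a suitable Zariski dense (concretely, nonempty Zariski open) subset of the space of configurations satisfying the stated conditions. *)

(* Defs.v *)
From HB Require Import structures.
From mathcomp Require Import all_boot all_order all_algebra.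
From mathcomp Require Import reals complex mpoly.

Set Implicit Arguments.
Unset Strict Implicit.
Unset Printing Implicit Defensive.

Import GRing.Theory.
Local Open Scope ring_scope.

Inductive real_or_complex : fieldType -> Prop :=
| Real_field (R : realType) : real_or_complex R
| Complex_field (R : realType) : real_or_complex R[i].

(* A projective subspace of dimension k - 1 of P^3(K) is a vector subspace of
   dimension k of K^4; incidence is inclusion, and the span of projective
   subspaces is the sum of vector subspaces. *)
Definition subsp (K : fieldType) (k : nat) :=
  {U : {vspace 'rV[K]_4} | \dim U == k}.

Coercion vspace_of_subsp (K : fieldType) (k : nat) (U : subsp K k) :
  {vspace 'rV[K]_4} := val U.

Notation point K := (subsp K 1).
Notation line K := (subsp K 2).
Notation plane K := (subsp K 3).

Section Incidence.
Variable K : fieldType.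

Definition general_position (A B C D : point K) : Prop :=
  (A + B + C + D)%VS = fullv.

(* Coherence of the tile with vertices labeled A, l, B, m in cyclic order.
   The definition is invariant under exchanging A and B, or l and m, so a tile
   listed starting from a line may be read starting from a point. *)
Definition coherent (A : point K) (l : line K) (B : point K) (m : line K)
    : Prop :=
  [/\ A != B, l != m,
      [/\ ~~ (A <= l)%VS, ~~ (A <= m)%VS, ~~ (B <= l)%VS & ~~ (B <= m)%VS] &
      exists P : point K, [/\ (P <= l)%VS, (P <= m)%VS & (P <= A + B)%VS]].

Definition triangle (A B C : point K) : Prop := \dim (A + B + C) = 3%N.

Definition perspective (A1 A2 A3 B1 B2 B3 : point K) : Prop :=
  [/\ A1 != B1, A2 != B2, A3 != B3 &
      exists O : point K,
        [/\ (O <= A1 + B1)%VS, (O <= A2 + B2)%VS & (O <= A3 + B3)%VS]].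

(* d is the Desargues line of the perspective triangles A1 A2 A3 and B1 B2 B3,
   where Ai corresponds to Bi: corresponding sides meet in single points, and
   d is the only line through these three points. *)
Definition desargues_line (A1 A2 A3 B1 B2 B3 : point K) (d : line K) : Prop :=
  [/\ triangle A1 A2 A3, triangle B1 B2 B3, perspective A1 A2 A3 B1 B2 B3 &
      exists Q12 Q13 Q23 : point K,
        [/\ ((A1 + A2) :&: (B1 + B2))%VS = Q12,
            ((A1 + A3) :&: (B1 + B3))%VS = Q13,
            ((A2 + A3) :&: (B2 + B3))%VS = Q23 &
            unique (fun g : line K =>
              [/\ (Q12 <= g)%VS, (Q13 <= g)%VS & (Q23 <= g)%VS]) d]].

Record configuration := Configuration {
  f0 : point K;
  f1 : line K; f2 : line K; f3 : line K;
  f12 : point K; f13 : point K; f23 : point K }.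

Definition admissible (c : configuration) : Prop :=
  [/\ general_position (f0 c) (f12 c) (f13 c) (f23 c),
      coherent (f0 c) (f1 c) (f12 c) (f2 c),
      coherent (f0 c) (f1 c) (f13 c) (f3 c) &
      coherent (f0 c) (f2 c) (f23 c) (f3 c)].

(* The ambient space (P^3)^4 x Gr(2,4)^3 of configurations carries the Zariski
   topology of a product of projective varieties, each Gr(2,4) being embedded
   by its Pluecker coordinates, recorded here as an antisymmetric 4 x 4
   matrix. *)
Definition point_coords (A : point K) (x : 'rV[K]_4) : Prop :=
  <[x]>%VS = A.

Definition line_coords (l : line K) (p : 'M[K]_4) : Prop :=
  exists u v : 'rV[K]_4,
    <<[:: u; v]>>%VS = l /\ p = \matrix_(i, j) (u 0 i * v 0 j - u 0 j * v 0 i).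

Definition ncoords : nat := (4 * 4 + (4 * 4 + (4 * 4 + 4 * 4)))%N.

Definition config_coords (c : configuration) (x : 'rV[K]_ncoords) : Prop :=
  exists (X : 'M[K]_4) (p1 p2 p3 : 'M[K]_4),
    [/\ [/\ point_coords (f0 c) (row 0 X), point_coords (f12 c) (row 1 X),
            point_coords (f13 c) (row 2 X) & point_coords (f23 c) (row 3 X)],
        line_coords (f1 c) p1, line_coords (f2 c) p2, line_coords (f3 c) p3 &
        x = row_mx (mxvec X) (row_mx (mxvec p1) (row_mx (mxvec p2) (mxvec p3)))].

(* Polynomials need not be multihomogeneous: over an infinite field, vanishing
   at every choice of homogeneous coordinates of c means that all
   multihomogeneous components vanish at c. *)
Definition zero_locus (S : {mpoly K[ncoords]} -> Prop) (c : configuration)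
    : Prop :=
  forall p, S p -> forall x, config_coords c x -> p.@[x 0] = 0.

Definition zariski_closed (Z : configuration -> Prop) : Prop :=
  exists S : {mpoly K[ncoords]} -> Prop, forall c, Z c <-> zero_locus S c.

Definition zariski_open (U : configuration -> Prop) : Prop :=
  zariski_closed (fun c => ~ U c).

(* P holds on a nonempty, dense, relatively open subset (X intersected with U)
   of X. *)
Definition generically (X P : configuration -> Prop) : Prop :=
  exists U : configuration -> Prop,
    [/\ zariski_open U,
        exists c, X c /\ U c,
        forall Z, zariski_closed Z -> (forall c, X c -> U c -> Z c) ->
          forall c, X c -> Z c &
        forall c, X c -> U c -> P c].

End Incidence.

(* Main.v *)
Require Import Defs.
From HB Require Import structures.
From mathcomp Require Import all_boot all_order all_algebra.
From mathcomp Require Import reals complex mpoly.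
From mathcomp Require Import ring.

Set Implicit Arguments.
Unset Strict Implicit.
Unset Printing Implicit Defensive.

Import GRing.Theory.
Local Open Scope ring_scope.

(** The point is that an admissible configuration has a normal form: up to a
    projective transformation there is only one.

    Choose a vector o spanning f.  Coherence of the tile (f, f1, f12, f2) puts
    a point of f1 and f2 on the line (f f12), different from f and from f12.
    Such a point is spanned by o + a, where a is a suitable multiple of any
    vector spanning f12 (coherent_vertex).  In the same way f13 and f23 are
    spanned by vectors b and c such that f1 and f3 meet in <o + b>, and f2 and
    f3 in <o + c>.  Since o, a, b, c are independent, the three lines are the
    sides of the triangle with vertices <o + a>, <o + b>, <o + c>
    (admissible_framed), and everything else is read off from the frame
    o, a, b, c.

    The plane h is <o + a, o + b, o + c>.  The line f1 = <o + a, o + b> meets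
    (f12 f13) = <a, b> only in <a - b>, so a line completing the first of the
    three new tiles must pass through <a - b> (edge_point_in_tile).  Likewise
    it passes through <a - c>, and these two points determine it.  The
    resulting line <a - b, a - c> is the intersection of h with <a, b, c>
    (axisE), and it does complete the three tiles (axis_tile).  It contains
    also <b - c>, so it is the Desargues line of the triangles <a>, <b>, <c>
    and <o + a>, <o + b>, <o + c>, which are in perspective from <o>
    (axis_desargues_line).

    Since every admissible configuration has this normal form, the open set
    witnessing genericity can be the whole space.  That this set is open rests
    on the existence of homogeneous coordinates for every configuration, and
    that it meets the admissible configurations is seen from any frame. *)

(** * Subspaces and coherence in terms of spanning vectors *)

Ltac row_ring := apply/rowP => ?; rewrite !mxE; ring.

Section Subspaces.
Variable K : fieldType.
Implicit Types (u v w : 'rV[K]_4) (U V : {vspace 'rV[K]_4}).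

Lemma memv_add_lines u v w :
  reflect (exists k l, w = k *: u + l *: v) (w \in <[u]> + <[v]>)%VS.
Proof.
apply: (iffP memv_addP) => [[_ /vlineP[k ->] [_ /vlineP[l ->] ->]] |].
  by exists k, l.
case=> k [l ->].
exists (k *: u); first by rewrite memvZ ?memv_line.
by exists (l *: v); rewrite ?memvZ ?memv_line.
Qed.

Lemma memv_add3_lines u v w x :
  reflect (exists k l m, x = k *: u + l *: v + m *: w)
          (x \in <[u]> + <[v]> + <[w]>)%VS.
Proof.
apply: (iffP memv_addP) => [[_ /memv_add_lines[k [l ->]]] |].
  by case=> _ /vlineP[m ->] ->; exists k, l, m.
case=> k [l [m ->]]; exists (k *: u + l *: v).
  by apply/memv_add_lines; exists k, l.
by exists (m *: w); rewrite ?memvZ ?memv_line.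
Qed.

Lemma dim_add_lines u v : free [:: u; v] -> \dim (<[u]> + <[v]>) = 2.
Proof. by rewrite /free span_cons (span_seq1 v) => /eqP. Qed.

Lemma dim_add3_lines u v w :
  free [:: u; v; w] -> \dim (<[u]> + <[v]> + <[w]>) = 3.
Proof. by rewrite /free 2!span_cons (span_seq1 w) addvA => /eqP. Qed.

Definition Subsp (k : nat) U (dimU : \dim U = k) : subsp K k :=
  Sub U (introT eqP dimU).

Lemma subsp_eq k (W : subsp K k) U : (U <= W)%VS -> \dim U = k -> U = W.
Proof.
by move=> sUW dimU; apply/eqP; rewrite eqEdim sUW dimU (eqP (valP W)) /=.
Qed.

Definition Point u (u0 : u != 0) : point K :=
  Subsp (etrans (dim_vline u) (congr1 nat_of_bool u0)).

Lemma point_line (A : point K) : exists2 v, v != 0 & A = <[v]>%VS :> {vspace _}.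
Proof.
have dimA := eqP (valP A).
have nz : vpick (val A) != 0 by rewrite vpick0 -dimv_eq0 dimA.
exists (vpick (val A)) => //.
by apply/esym/subsp_eq; rewrite ?dim_vline ?nz // -memvE memv_pick.
Qed.

Lemma sub_point (A : point K) u U : A = <[u]>%VS :> {vspace _} ->
  (A <= U)%VS = (u \in U).
Proof. by move=> ->; rewrite memvE. Qed.

Lemma point_neq (A B : point K) u :
  A = <[u]>%VS :> {vspace _} -> u \notin vspace_of_subsp B -> A != B.
Proof. by move=> defA; apply: contraNneq => <-; rewrite defA memv_line. Qed.

(** Neither A nor B can be the common point P of l and m, as they lie on
    neither line.  So P = <k u + s v> with k and s nonzero, and rescaling v
    alone turns this spanning vector into u + t v. *)
Lemma coherent_vertex (A B : point K) (l m : line K) u v :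
    A = <[u]>%VS :> {vspace _} -> B = <[v]>%VS :> {vspace _} ->
    coherent A l B m ->
  exists t, [/\ B = <[t *: v]>%VS :> {vspace _},
                u + t *: v \in vspace_of_subsp l &
                u + t *: v \in vspace_of_subsp m].
Proof.
move=> defA defB [_ _ [Al _ Bl _] [P [Pl Pm PAB]]].
have [p p0 defP] := point_line P.
move: Pl Pm PAB Al Bl; rewrite !(sub_point _ defP) !(sub_point _ defA).
rewrite !(sub_point _ defB) defA defB => pl pm.
case/memv_add_lines=> k [s defp] ul vl.
have k0 : k != 0.
  apply: contraNneq vl => k0; move: pl p0; rewrite defp k0 scale0r add0r.
  by rewrite rpredZeq => /orP[/eqP-> | //]; rewrite scale0r eqxx.
have s0 : s != 0.
  apply: contraNneq ul => s0; move: pl p0; rewrite defp s0 scale0r addr0.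
  by rewrite rpredZeq => /orP[/eqP-> | //]; rewrite scale0r eqxx.
exists (s / k); have -> : u + (s / k) *: v = k^-1 *: p.
  by rewrite defp scalerDr !scalerA mulVf // scale1r mulrC.
split; try by rewrite memvZ.
apply/eqP; rewrite eqEdim !dim_vline scaler_eq0 mulf_eq0 invr_eq0.
rewrite (negPf s0) (negPf k0) /= leqnn andbT -memvE.
apply/vlineP; exists (k / s); rewrite scalerA.
by have -> : k / s * (s / k) = 1; [field; apply/andP | rewrite scale1r].
Qed.

(** The vector x, on l but not on m, tells these two lines apart. *)
Lemma coherent_intro (A B : point K) (l m : line K) u v t x :
    A = <[u]>%VS :> {vspace _} -> B = <[v]>%VS :> {vspace _} ->
    [/\ u \notin vspace_of_subsp l, u \notin vspace_of_subsp m,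
        v \notin vspace_of_subsp l & v \notin vspace_of_subsp m] ->
    u + t *: v \in vspace_of_subsp l -> u + t *: v \in vspace_of_subsp m ->
    u \notin <[v]>%VS ->
    x \in vspace_of_subsp l -> x \notin vspace_of_subsp m ->
  coherent A l B m.
Proof.
move=> defA defB [ul um vl vm] pl pm uv xl xm.
have p0 : u + t *: v != 0.
  apply: contraNneq uv => /eqP; rewrite addr_eq0 => /eqP ->.
  by rewrite memvN memvZ ?memv_line.
split.
- by apply: (point_neq defA); rewrite defB.
- by apply: contraNneq xm => <-.
- by split; rewrite ?(sub_point _ defA) ?(sub_point _ defB).
exists (Point p0); split; rewrite /= -?memvE //.
by rewrite defA defB memv_add ?memvZ ?memv_line.
Qed.

End Subspaces.

(** * Frames and the figure they carry *)

Section Frames.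
Variable K : fieldType.
Implicit Types (o a b c w : 'rV[K]_4).

Definition frame o a b c := free [:: o; a; b; c].

(** The Desargues figure in coordinates: a frame o, a, b, c gives the triangles
    <a>, <b>, <c> and <o + a>, <o + b>, <o + c>, in perspective from the apex
    <o>.  Choosing the second triangle with coefficients 1 loses no generality,
    as a, b, c may be rescaled.  The perspective axis is the intersection of the
    planes of the two triangles. *)
Definition side o a b := (<[o + a]> + <[o + b]>)%VS.
Definition side_plane o a b c := (<[o + a]> + <[o + b]> + <[o + c]>)%VS.
Definition axis o a b c := (side_plane o a b c :&: (<[a]> + <[b]> + <[c]>))%VS.

(* The figure is symmetric in a, b, c: the swaps below transport each fact about
   one vertex or one side to the others. *)

Lemma frame_swap23 o a b c : frame o a b c -> frame o a c b.
Proof.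
rewrite /frame (@perm_free _ _ _ [:: o; a; c; b]) //.
by rewrite !perm_cons (perm_catC [:: b]).
Qed.

Lemma frame_swap12 o a b c : frame o a b c -> frame o b a c.
Proof.
rewrite /frame (@perm_free _ _ _ [:: o; b; a; c]) //.
by rewrite perm_cons (perm_catCA [:: a] [:: b]).
Qed.

Lemma sideC o a b : side o a b = side o b a.
Proof. exact: addvC. Qed.

Lemma side_plane_swap12 o a b c : side_plane o a b c = side_plane o b a c.
Proof. by rewrite /side_plane (addvC <[o + a]>%VS). Qed.

Lemma side_plane_swap23 o a b c : side_plane o a b c = side_plane o a c b.
Proof. by rewrite /side_plane -!addvA (addvC <[o + b]>%VS). Qed.

Lemma axis_swap12 o a b c : axis o a b c = axis o b a c.
Proof. by rewrite /axis side_plane_swap12 (addvC <[a]>%VS). Qed.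

Lemma axis_swap23 o a b c : axis o a b c = axis o a c b.
Proof.
rewrite /axis side_plane_swap23.
by rewrite -[(_ + <[c]>)%VS]addvA (addvC <[b]>%VS) addvA.
Qed.

Lemma frame_inj o a b c x0 x1 x2 x3 y0 y1 y2 y3 : frame o a b c ->
    x0 *: o + x1 *: a + x2 *: b + x3 *: c
      = y0 *: o + y1 *: a + y2 *: b + y3 *: c ->
  [/\ x0 = y0, x1 = y1, x2 = y2 & x3 = y3].
Proof.
move=> F E.
have E0 : (x0 - y0) *: o + (x1 - y1) *: a + (x2 - y2) *: b + (x3 - y3) *: c = 0.
  by move/eqP: E; rewrite -subr_eq0 => /eqP <-; row_ring.
pose x := [tuple x0 - y0; x1 - y1; x2 - y2; x3 - y3].
have /freeP/(_ (fun i => x`_i)) : free [tuple o; a; b; c] by [].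
rewrite !big_ord_recl big_ord0 /= addr0 !addrA => /(_ E0) H.
by split; apply/eqP; rewrite -subr_eq0; apply/eqP;
  [exact: (H 0) | exact: (H 1) | exact: (H 2) | exact: (H 3)].
Qed.

(** Four vectors spanning a space that contains a frame are again a frame, by
    dimension.  The non-incidences in the figure all come from such changes of
    frame. *)
Lemma frame_change o a b c (X : seq 'rV[K]_4) : frame o a b c -> size X = 4%N ->
  o \in <<X>>%VS -> a \in <<X>>%VS -> b \in <<X>>%VS -> c \in <<X>>%VS ->
  free X.
Proof.
move=> /eqP F sX oX aX bX cX; rewrite /free eqn_leq dim_span /= sX -[leqLHS]F.
apply/dimvS/span_subvP => w; rewrite !inE.
by do ![case/predU1P => [-> //|]] => /eqP->.
Qed.

Lemma frame_translate o a b c :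
  frame o a b c -> frame o (o + a) (o + b) (o + c).
Proof.
rewrite {2}/frame; set X := [:: _; _; _; _] => F.
have o_in : o \in <<X>>%VS by rewrite memv_span ?mem_head.
have sub_in w : o + w \in X -> w \in <<X>>%VS.
  by move=> /memv_span ow; rewrite -(addKr o w) memvD ?memvN.
by apply: (frame_change F) => //; apply: sub_in; rewrite !inE eqxx ?orbT.
Qed.

Lemma frame_translate_vertex o a b c :
  frame o a b c -> frame a (o + a) (o + b) (o + c).
Proof.
rewrite {2}/frame; set X := [:: _; _; _; _] => F.
have a_in : a \in <<X>>%VS by rewrite memv_span ?mem_head.
have o_in : o \in <<X>>%VS.
  by rewrite -(addrK a o) memvB // memv_span // !inE eqxx orbT.
have sub_in w : o + w \in X -> w \in <<X>>%VS.
  by move=> /memv_span ow; rewrite -(addKr o w) memvD ?memvN.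
by apply: (frame_change F) => //; apply: sub_in; rewrite !inE eqxx ?orbT.
Qed.

Lemma frame_translate_apex o a b c : frame o a b c -> frame (o + a) a b c.
Proof.
rewrite {2}/frame; set X := [:: _; _; _; _] => F.
apply: (frame_change F) => //; last 3 first.
- by rewrite memv_span // !inE eqxx ?orbT.
- by rewrite memv_span // !inE eqxx ?orbT.
- by rewrite memv_span // !inE eqxx ?orbT.
by rewrite -(addrK a o) memvB // memv_span // !inE eqxx ?orbT.
Qed.

Lemma frame_differences o a b c : frame o a b c -> frame o a (a - b) (a - c).
Proof.
rewrite {2}/frame; set X := [:: _; _; _; _] => F.
apply: (frame_change F) => //.
- by rewrite memv_span // !inE eqxx ?orbT.
- by rewrite memv_span // !inE eqxx ?orbT.
- by rewrite -(subKr a b) memvB // memv_span // !inE eqxx ?orbT.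
by rewrite -(subKr a c) memvB // memv_span // !inE eqxx ?orbT.
Qed.

Lemma frame_free3 o a b c : frame o a b c -> free [:: a; b; c].
Proof. by rewrite /frame free_cons => /andP[]. Qed.

Lemma frame_free2 o a b c : frame o a b c -> free [:: b; c].
Proof. by move=> /frame_free3; rewrite free_cons => /andP[]. Qed.

Lemma frame_neq0 o a b c : frame o a b c -> c != 0.
Proof. by move=> /frame_free2; rewrite free_cons seq1_free => /andP[]. Qed.

Lemma frame_notin o a b c :
  frame o a b c -> o \notin (<[a]> + <[b]> + <[c]>)%VS.
Proof.
by rewrite /frame free_cons 2!span_cons (span_seq1 c) addvA => /andP[].
Qed.

Section FrameFigure.
Variables o a b c : 'rV[K]_4.
Hypothesis F : frame o a b c.

Lemma sub_side_plane : (side o a b <= side_plane o a b c)%VS.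
Proof. exact: addvSl. Qed.

Lemma dim_side : \dim (side o a b) = 2%N.
Proof.
have Fcab := frame_swap12 (frame_swap23 F).
exact/dim_add_lines/(frame_free2 (frame_translate Fcab)).
Qed.

Lemma dim_side_plane : \dim (side_plane o a b c) = 3%N.
Proof. exact/dim_add3_lines/(frame_free3 (frame_translate F)). Qed.

Lemma apex_notin_side : o \notin side o a b.
Proof.
by apply: contra (frame_notin (frame_translate F)); apply/subvP/sub_side_plane.
Qed.

Lemma vertex_notin_plane : a \notin side_plane o a b c.
Proof. exact: frame_notin (frame_translate_vertex F). Qed.

Lemma vertex_notin_side : a \notin side o a b.
Proof. by apply: contra vertex_notin_plane; apply/subvP/sub_side_plane. Qed.

Lemma opposite_notin_side : o + c \notin side o a b.
Proof.
have := frame_free3 (frame_translate (frame_swap12 (frame_swap23 F))).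
by rewrite free_cons span_cons (span_seq1 (o + b)) => /andP[].
Qed.

Lemma meet_notin_axis : o + a \notin axis o a b c.
Proof.
rewrite memv_cap negb_and; apply/orP; right.
exact: frame_notin (frame_translate_apex F).
Qed.

Lemma vertex_notin_axis : a \notin axis o a b c.
Proof. by rewrite memv_cap (negPf vertex_notin_plane). Qed.

Lemma vertex_neq : a \notin <[b]>%VS.
Proof.
have := frame_free2 (frame_swap12 (frame_swap23 F)).
by rewrite free_cons (span_seq1 b) => /andP[].
Qed.

Lemma apex_neq0 : o != 0.
Proof. by apply: contraNneq (frame_notin F) => ->; exact: mem0v. Qed.

Lemma apex_neq : o \notin <[a]>%VS.
Proof.
by apply: contra (frame_notin F); apply/subvP; rewrite -addvA addvSl.
Qed.

(** A combination of o + a, o + b, o + c lies in <a, b, c> exactly when its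
    coefficients sum to zero, that is, when it combines differences of them. *)
Lemma axisE : axis o a b c = (<[a - b]> + <[a - c]>)%VS.
Proof.
apply/vspaceP => w; rewrite memv_cap.
apply/andP/memv_add_lines => [|[k [l ->]]].
  case=> /memv_add3_lines[k [l [m Ew]]] /memv_add3_lines[k' [l' [m' Ew']]].
  rewrite Ew in Ew' *; exists (- l), (- m).
  have [klm _ _ _] : [/\ k + l + m = 0, k = k', l = l' & m = m'].
    apply: (frame_inj F); rewrite scale0r add0r -Ew'; row_ring.
  have -> : k = - (l + m) by apply/eqP; rewrite -addr_eq0 addrA klm.
  row_ring.
split; apply/memv_add3_lines.
  by exists (k + l), (- k), (- l); row_ring.
by exists (k + l), (- k), (- l); row_ring.
Qed.

Lemma edge_point_on_axis : a - b \in axis o a b c.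
Proof. by rewrite axisE (subvP (addvSl _ _)) ?memv_line. Qed.

Lemma dim_axis : \dim (axis o a b c) = 2%N.
Proof. by rewrite axisE (dim_add_lines (frame_free2 (frame_differences F))). Qed.

Lemma edge_cap_side : ((<[a]> + <[b]>) :&: side o a b)%VS = <[a - b]>%VS.
Proof.
apply/vspaceP => w; rewrite memv_cap; apply/andP/vlineP => [|[k ->]].
  case=> /memv_add_lines[k [l Ew]] /memv_add_lines[k' [l' Ew']].
  rewrite Ew in Ew' *; exists k.
  have [kl -> -> _] : [/\ 0 = k' + l', k = k', l = l' & (0 : K) = 0].
    apply: (frame_inj F); rewrite !scale0r add0r addr0 Ew'; row_ring.
  have -> : l' = - k' by apply/eqP; rewrite -addr_eq0 addrC -kl.
  row_ring.
split; apply/memv_add_lines; exists k, (- k); row_ring.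
Qed.

End FrameFigure.

(** * Coherent tiles of the figure *)

Lemma apex_tile o a b c (A B : point K) (l m : line K) : frame o a b c ->
    A = <[o]>%VS :> {vspace _} -> B = <[a]>%VS :> {vspace _} ->
    l = side o a b :> {vspace _} -> m = side o a c :> {vspace _} ->
  coherent A l B m.
Proof.
move=> F defA defB defl defm; have F' := frame_swap23 F.
apply: (coherent_intro (t := 1) (x := o + b) defA defB);
  rewrite ?scale1r ?defl ?defm.
- split; first [exact: apex_notin_side F | exact: apex_notin_side F' |
                exact: vertex_notin_side F | exact: vertex_notin_side F'].
- by rewrite (subvP (addvSl _ _)) ?memv_line.
- by rewrite (subvP (addvSl _ _)) ?memv_line.
- exact: apex_neq F.
- by rewrite (subvP (addvSr _ _)) ?memv_line.
exact: opposite_notin_side F'.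
Qed.

Lemma axis_tile o a b c (A B : point K) (l g : line K) : frame o a b c ->
    A = <[a]>%VS :> {vspace _} -> B = <[b]>%VS :> {vspace _} ->
    l = side o a b :> {vspace _} -> g = axis o a b c :> {vspace _} ->
  coherent A l B g.
Proof.
move=> F defA defB defl defg; have F' := frame_swap12 F.
have ab_edge : a - b \in <[a - b]>%VS by apply: memv_line.
apply: (coherent_intro (t := - 1) (x := o + a) defA defB);
  rewrite ?scaleN1r ?defl ?defg.
- split; first [exact: vertex_notin_side F | exact: vertex_notin_axis F |
     rewrite sideC; exact: vertex_notin_side F' |
     rewrite axis_swap12; exact: vertex_notin_axis F'].
- by move: ab_edge; rewrite -(edge_cap_side F) memv_cap => /andP[].
- exact: edge_point_on_axis F.
- exact: vertex_neq F.
- by rewrite (subvP (addvSl _ _)) ?memv_line.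
exact: meet_notin_axis F.
Qed.

(** The common point of l and g lies on the line (A B), which meets the side l
    in <a - b> only. *)
Lemma edge_point_in_tile o a b c (A B : point K) (l g : line K) :
    frame o a b c ->
    A = <[a]>%VS :> {vspace _} -> B = <[b]>%VS :> {vspace _} ->
    l = side o a b :> {vspace _} ->
  coherent A l B g -> a - b \in vspace_of_subsp g.
Proof.
move=> F defA defB defl /(coherent_vertex defA defB)[t [_]].
set p := a + t *: b; rewrite defl => pl pg.
have : p \in <[a - b]>%VS.
  rewrite -(edge_cap_side F) memv_cap pl andbT.
  by rewrite memv_add ?memvZ ?memv_line.
case/vlineP=> k defp; move: pg; rewrite defp rpredZeq => /orP[/eqP k0 | //].
case/negP: (vertex_neq F).
move/eqP: defp; rewrite k0 scale0r addr_eq0 => /eqP->.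
by rewrite memvN memvZ ?memv_line.
Qed.

(** * Normal form of admissible configurations *)

(** The normal form: f is the apex, and the lines are the sides of the triangle
    <o + a>, <o + b>, <o + c>, numbered so that f1 and f2 meet in <o + a>,
    f1 and f3 in <o + b>, f2 and f3 in <o + c>. *)
Definition framed_by (cf : configuration K) o a b c : Prop :=
  [/\ frame o a b c,
      [/\ f0 cf = <[o]>%VS :> {vspace _}, f12 cf = <[a]>%VS :> {vspace _},
          f13 cf = <[b]>%VS :> {vspace _} & f23 cf = <[c]>%VS :> {vspace _}] &
      [/\ f1 cf = side o a b :> {vspace _}, f2 cf = side o a c :> {vspace _} &
          f3 cf = side o b c :> {vspace _}]].

Lemma frame_general_position o a b c (A B C D : point K) :
    A = <[o]>%VS :> {vspace _} -> B = <[a]>%VS :> {vspace _} ->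
    C = <[b]>%VS :> {vspace _} -> D = <[c]>%VS :> {vspace _} ->
  general_position A B C D <-> frame o a b c.
Proof.
move=> defA defB defC defD; rewrite /general_position defA defB defC defD.
have spanE : (<[o]> + <[a]> + <[b]> + <[c]>)%VS = span [:: o; a; b; c].
  by rewrite 3!span_cons (span_seq1 c) !addvA.
rewrite spanE /frame /free; split=> [->|/eqP dim4].
  by rewrite dimvf dim_matrix.
by apply/eqP; rewrite eqEdim subvf dimvf dim_matrix dim4.
Qed.

Lemma framed_admissible cf o a b c : framed_by cf o a b c -> admissible cf.
Proof.
case=> F [d0 d12 d13 d23] [d1 d2 d3].
split; first exact/(frame_general_position d0 d12 d13 d23).
- exact: apex_tile F d0 d12 d1 d2.
- by apply: (apex_tile (frame_swap12 F) d0 d13) => //; rewrite d1 sideC.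
apply: (apex_tile (frame_swap12 (frame_swap23 F)) d0 d23).
  by rewrite d2 sideC.
by rewrite d3 sideC.
Qed.

(** The three tiles give, by rescaling, vectors a, b, c with o + a on f1 and f2,
    o + b on f1 and f3, and o + c on f2 and f3.  Each line then contains two
    independent vectors of the figure, hence is the side they span. *)
Lemma admissible_framed cf :
  admissible cf -> exists o a b c, framed_by cf o a b c.
Proof.
case=> gp t12 t13 t23.
have [o _ d0] := point_line (f0 cf).
have [a' _ d12'] := point_line (f12 cf).
have [b' _ d13'] := point_line (f13 cf).
have [c' _ d23'] := point_line (f23 cf).
have [k [d12 a1 a2]] := coherent_vertex d0 d12' t12.
have [l [d13 b1 b3]] := coherent_vertex d0 d13' t13.
have [m [d23 c2 c3]] := coherent_vertex d0 d23' t23.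
set a := k *: a' in d12 a1 a2; set b := l *: b' in d13 b1 b3.
set c := m *: c' in d23 c2 c3; exists o, a, b, c.
have F : frame o a b c by apply/(frame_general_position d0 d12 d13 d23).
split=> //; split; apply/esym/subsp_eq.
- by rewrite /side subv_add -!memvE a1.
- exact: dim_side F.
- by rewrite /side subv_add -!memvE a2.
- exact: dim_side (frame_swap23 F).
- by rewrite /side subv_add -!memvE b3.
exact: dim_side (frame_swap23 (frame_swap12 F)).
Qed.

(** * The eighth line *)

Lemma sides_unique_plane cf o a b c (F : frame o a b c) :
    framed_by cf o a b c ->
  unique (fun h : plane K =>
    [/\ (f1 cf <= h)%VS, (f2 cf <= h)%VS & (f3 cf <= h)%VS])
    (Subsp (dim_side_plane F)).
Proof.
case=> _ _ [d1 d2 d3].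
have plane_oa : (<[o + a]> <= side_plane o a b c)%VS.
  by rewrite /side_plane -addvA addvSl.
have plane_ob : (<[o + b]> <= side_plane o a b c)%VS.
  by exact: subv_trans (addvSr _ _) (addvSl _ _).
have plane_oc : (<[o + c]> <= side_plane o a b c)%VS by rewrite addvSr.
split=> [|h [h1 h2 _]].
  by rewrite d1 d2 d3 !subv_add plane_oa plane_ob plane_oc.
apply/val_inj/subsp_eq; last exact: dim_side_plane F.
by move: h1 h2; rewrite d1 d2 !subv_add => /andP[-> ->] /andP[_ ->].
Qed.

Lemma axis_line o a b c (g : line K) : frame o a b c ->
    a - b \in vspace_of_subsp g -> a - c \in vspace_of_subsp g ->
  axis o a b c = g.
Proof.
move=> F ab ac; apply: subsp_eq; last exact: dim_axis F.
by rewrite (axisE F) subv_add -!memvE ab ac.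
Qed.

(** Two of the three tiles already force g through <a - b> and <a - c>. *)
Lemma axis_unique_tile_line cf o a b c (F : frame o a b c) :
    framed_by cf o a b c ->
  unique (fun g : line K =>
    [/\ coherent (f12 cf) (f1 cf) (f13 cf) g,
        coherent (f12 cf) (f2 cf) (f23 cf) g &
        coherent (f13 cf) (f3 cf) (f23 cf) g]) (Subsp (dim_axis F)).
Proof.
case=> _ [_ d12 d13 d23] [d1 d2 d3].
have Facb := frame_swap23 F; have Fbca := frame_swap23 (frame_swap12 F).
split=> [|g [t1 t2 _]].
  split; first by apply: (axis_tile F d12 d13 d1).
    by apply: (axis_tile Facb d12 d23 d2); exact: axis_swap23.
  apply: (axis_tile Fbca d13 d23 d3).
  exact: etrans (axis_swap12 o a b c) (axis_swap23 o b a c).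
apply/val_inj/(axis_line F).
  exact: edge_point_in_tile F d12 d13 d1 t1.
exact: edge_point_in_tile Facb d12 d23 d2 t2.
Qed.

Lemma axis_desargues_line o a b c (F : frame o a b c)
    (A B C P Q R : point K) :
    [/\ A = <[a]>%VS :> {vspace _}, B = <[b]>%VS :> {vspace _} &
        C = <[c]>%VS :> {vspace _}] ->
    [/\ P = <[o + a]>%VS :> {vspace _}, Q = <[o + b]>%VS :> {vspace _} &
        R = <[o + c]>%VS :> {vspace _}] ->
  desargues_line A B C P Q R (Subsp (dim_axis F)).
Proof.
case=> dA dB dC [dP dQ dR].
have Facb := frame_swap23 F; have Fbac := frame_swap12 F.
have Fbca := frame_swap23 Fbac; have Fcab := frame_swap12 Facb.
have vertex_neq_side u v w (U W : point K) : frame o u v w ->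
    U = <[u]>%VS :> {vspace _} -> W = <[o + u]>%VS :> {vspace _} -> U != W.
  move=> F' dU dW; apply: (point_neq dU); rewrite dW.
  apply: contra (vertex_notin_plane F'); apply/subvP.
  by rewrite /side_plane -addvA addvSl.
have [ab0 [ac0 bc0]] : a - b != 0 /\ a - c != 0 /\ b - c != 0.
  split; first exact: frame_neq0 (frame_differences Facb).
  split; first exact: frame_neq0 (frame_differences F).
  exact: frame_neq0 (frame_differences Fbac).
split.
- by rewrite /triangle dA dB dC; exact/dim_add3_lines/(frame_free3 F).
- by rewrite /triangle dP dQ dR; exact: dim_side_plane F.
- split; [exact: vertex_neq_side F dA dP | exact: vertex_neq_side Fbac dB dQ |
          exact: vertex_neq_side Fcab dC dR | ].
  have o0 := apex_neq0 F; exists (Point o0); rewrite dA dB dC dP dQ dR.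
  by split; rewrite -memvE; apply/memv_add_lines; exists (- 1), 1; row_ring.
exists (Point ab0), (Point ac0), (Point bc0); rewrite dA dB dC dP dQ dR; split.
- exact: edge_cap_side F.
- exact: edge_cap_side Facb.
- exact: edge_cap_side Fbca.
split=> [|g [ab ac _]]; last by apply/val_inj/(axis_line F); rewrite memvE.
rewrite -!memvE; split; first exact: edge_point_on_axis F.
  by have := edge_point_on_axis Facb; rewrite -axis_swap23.
by have := edge_point_on_axis Fbca; rewrite -axis_swap23 -axis_swap12.
Qed.

(** * Genericity *)

Lemma exists_admissible : exists cf : configuration K, admissible cf.
Proof.
have [o [a [b [c F]]]] : exists o a b c, frame o a b c.
  have /= := basis_free (vbasisP {:'rV[K]_4}).
  have /= := size_tuple (vbasis {:'rV[K]_4}).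
  case: (tval _) => [|o [|a [|b [|c [|? ?]]]]]; rewrite dimvf dim_matrix //.
  by exists o, a, b, c.
have Fbca := frame_swap23 (frame_swap12 F).
exists (Configuration (Point (apex_neq0 F))
  (Subsp (dim_side F)) (Subsp (dim_side (frame_swap23 F)))
  (Subsp (dim_side Fbca))
  (Point (frame_neq0 Fbca)) (Point (frame_neq0 (frame_swap23 F)))
  (Point (frame_neq0 F))).
by apply: (@framed_admissible _ o a b c).
Qed.

Lemma exists_config_coords (cf : configuration K) : exists x, config_coords cf x.
Proof.
have point_vec (A : point K) : exists v, point_coords A v.
  by have [v _ defA] := point_line A; exists v; rewrite /point_coords defA.
have line_vec (l : line K) : exists p, line_coords l p.
  have /= := span_basis (vbasisP (val l)).
  have /= := size_tuple (vbasis (val l)).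
  case: (tval _) => [|u [|v [|? ?]]]; rewrite (eqP (valP l)) // => _ defl.
  by exists (\matrix_(i, j) (u 0 i * v 0 j - u 0 j * v 0 i)), u, v.
have [[o defo] [a defa]] := (point_vec (f0 cf), point_vec (f12 cf)).
have [[b defb] [c defc]] := (point_vec (f13 cf), point_vec (f23 cf)).
have [p1 def1] := line_vec (f1 cf).
have [p2 def2] := line_vec (f2 cf).
have [p3 def3] := line_vec (f3 cf).
pose X : 'M[K]_4 := \matrix_i [tuple o; a; b; c]`_i.
eexists; exists X, p1, p2, p3; split=> //.
by rewrite !rowK.
Qed.

(** The empty set is the zero locus of the constant 1; it must be checked that
    this locus is not vacuously everything, which could only happen at a
    configuration without coordinates. *)
Lemma zariski_open_full : zariski_open (fun _ : configuration K => True).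
Proof.
exists (fun p => p = 1) => cf; split=> [|vanish]; first by case.
have [x cx] := exists_config_coords cf.
by have /eqP := vanish 1 erefl x cx; rewrite meval1 oner_eq0.
Qed.

End Frames.

Theorem proposition9p4 (K : fieldType) (hK : real_or_complex K) :
  generically (@admissible K) (fun c =>
    exists h : plane K,
      unique (fun h' : plane K =>
        [/\ (f1 c <= h')%VS, (f2 c <= h')%VS & (f3 c <= h')%VS]) h /\
      exists f123 : line K,
        [/\ unique (fun g : line K =>
              [/\ coherent (f12 c) (f1 c) (f13 c) g,
                  coherent (f12 c) (f2 c) (f23 c) g &
                  coherent (f13 c) (f3 c) (f23 c) g]) f123,
            vspace_of_subsp f123 = (h :&: (f12 c + f13 c + f23 c))%VS &
            exists P12 P13 P23 : point K,
              [/\ vspace_of_subsp (f1 c) = (P12 + P13)%VS,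
                  vspace_of_subsp (f2 c) = (P12 + P23)%VS,
                  vspace_of_subsp (f3 c) = (P13 + P23)%VS &
                  desargues_line (f12 c) (f13 c) (f23 c) P12 P13 P23 f123]]).
Proof.
(* The normal form covers all admissible configurations, so the open set is
   the whole space and density is immediate. *)
exists (fun _ => True); split; first exact: zariski_open_full.
- by have [cf cfP] := exists_admissible K; exists cf.
- by move=> Z _ sub_Z cf cfP; apply: sub_Z.
move=> cf /admissible_framed[o [a [b [c cfP]]]] _.
have [F [_ d12 d13 d23] [d1 d2 d3]] := cfP.
exists (Subsp (dim_side_plane F)); split; first exact: sides_unique_plane cfP.
exists (Subsp (dim_axis F)); split; first exact: axis_unique_tile_line cfP.
  by rewrite d12 d13 d23.
have FT := frame_translate F.
exists (Point (frame_neq0 (frame_swap23 (frame_swap12 FT)))).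
exists (Point (frame_neq0 (frame_swap23 FT))), (Point (frame_neq0 FT)).
by split=> //; apply: axis_desargues_line.
Qed.
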